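(* $$F_{231}(x,y)=\frac{1-2x+2xy-\sqrt{1-4x+4x^2-4x^2y}}{2xy},$$ that is, for all $r,n\ge 0$, $$F_{231;r}(x)=\frac{1}{r+1}\binom{2r}{r}\frac{x^{2r+1}}{(1-2x)^{2r+1}},\qquad f_{231;r}(n)=\frac{2^{n-2r-1}}{r+1}\binom{n-1}{2r}\binom{2r}{r}.$$
   Context: The pattern $231$ is written without dashes, so an occurrence of $231$ in $\pi=\pi_1\cdots\pi_n\in S_n$ is a position $i$ with $i+2\le n$ and $\pi_{i+2}<\pi_i<\pi_{i+1}$. A permutation is $1\text{-}3\text{-}2$-avoiding if there are no positions $a<b<c$ with $\pi_a<\pi_c<\pi_b$. $f_{\tau;r}(n)$ is the number of $1\text{-}3\text{-}2$-avoiding permutations in $S_n$ containing exactly $r$ occurrences of $\tau$ (with $S_0$ consisting of the empty permutation), $F_{\tau;r}(x)=\sum_{n\ge0}f_{\tau;r}(n)x^n$, and $F_\tau(x,y)=\sum_{r\ge 0} F_{\tau;r}(x)y^r$. The square root denotes the formal power series in $x$ with constant term $1$. The binomial coefficient $\binom ab$ is taken to be $0$ whenever $a<b$ or $b<0$.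
   Formalization: The second and third formulas miss the empty permutation (at r=n=0 the count is 1 but the formula gives 0), so the formal statement adds 1 to F_{231;r}(x) when r=0 and to f_{231;r}(n) when r=n=0; all else is as stated. *)

(* Defs.v *)
From HB Require Import structures.
From mathcomp Require Import all_boot all_order all_algebra all_fingroup.
From mathcomp Require Import boolp.

Set Implicit Arguments.
Unset Strict Implicit.
Unset Printing Implicit Defensive.

Import GRing.Theory.
Local Open Scope ring_scope.

Record fps (R : Type) := Fps { coefs : nat -> R }.

Lemma fpsP (R : Type) (a b : fps R) : coefs a =1 coefs b -> a = b.
Proof. by case: a b => [a] [b] /= /funext ->. Qed.

HB.instance Definition _ (R : Type) := gen_eqMixin (fps R).
HB.instance Definition _ (R : Type) := gen_choiceMixin (fps R).

Definition fps_zero (R : zmodType) : fps R := Fps (fun=> 0).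
Definition fps_opp (R : zmodType) (a : fps R) := Fps (fun n => - coefs a n).
Definition fps_add (R : zmodType) (a b : fps R) :=
  Fps (fun n => coefs a n + coefs b n).

Lemma fps_addA (R : zmodType) : associative (@fps_add R).
Proof. by move=> a b c; apply: fpsP => n /=; rewrite addrA. Qed.
Lemma fps_addC (R : zmodType) : commutative (@fps_add R).
Proof. by move=> a b; apply: fpsP => n /=; rewrite addrC. Qed.
Lemma fps_add0 (R : zmodType) : left_id (fps_zero R) (@fps_add R).
Proof. by move=> a; apply: fpsP => n /=; rewrite add0r. Qed.
Lemma fps_addN (R : zmodType) :
  left_inverse (fps_zero R) (@fps_opp R) (@fps_add R).
Proof. by move=> a; apply: fpsP => n /=; rewrite addNr. Qed.

HB.instance Definition _ (R : zmodType) := GRing.isZmodule.Build (fps R)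
  (@fps_addA R) (@fps_addC R) (@fps_add0 R) (@fps_addN R).

Definition fpsC (R : zmodType) (c : R) : fps R :=
  Fps (fun n => if n is 0 then c else 0).
Definition fps_mul (R : comNzRingType) (a b : fps R) : fps R :=
  Fps (fun n => \sum_(i < n.+1) coefs a i * coefs b (n - i)%N).

Definition fps_trunc (R : comNzRingType) (N : nat) (a : fps R) : {poly R} :=
  \poly_(i < N) coefs a i.

Lemma fps_mul_trunc (R : comNzRingType) (N n : nat) (a b : fps R) : (n < N)%N ->
  coefs (fps_mul a b) n = (fps_trunc N a * fps_trunc N b)`_n.
Proof.
move=> ltnN; rewrite coefM /=; apply: eq_bigr => i _; rewrite !coef_poly.
rewrite (leq_ltn_trans _ ltnN) ?(leq_ltn_trans _ ltnN) ?leq_subr //.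
by rewrite -ltnS.
Qed.

Lemma fps_mulC (R : comNzRingType) : commutative (@fps_mul R).
Proof.
by move=> a b; apply: fpsP => n; rewrite !(fps_mul_trunc _ _ (ltnSn n)) mulrC.
Qed.

Lemma fps_mulA (R : comNzRingType) : associative (@fps_mul R).
Proof.
move=> a b c; apply: fpsP => n; set N := n.+1.
have -> : coefs (fps_mul a (fps_mul b c)) n =
    (fps_trunc N a * (fps_trunc N b * fps_trunc N c))`_n.
  rewrite coefM {1}/fps_mul /=; apply: eq_bigr => i _.
  by rewrite -fps_mul_trunc ?ltnS ?leq_subr // coef_poly ltn_ord.
rewrite mulrA coefM {1}/fps_mul /=; apply: eq_bigr => i _.
by rewrite -(fps_mul_trunc _ _ (ltn_ord i)) coef_poly ltnS leq_subr.
Qed.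

Lemma fps_mul1 (R : comNzRingType) : left_id (fpsC (1 : R)) (@fps_mul R).
Proof.
move=> a; apply: fpsP => n /=; rewrite big_ord_recl /= mul1r subn0 big1 ?addr0 //.
by move=> i _; rewrite mul0r.
Qed.

Lemma fps_mulDl (R : comNzRingType) :
  left_distributive (@fps_mul R) (@fps_add R).
Proof.
move=> a b c; apply: fpsP => n /=; rewrite -big_split.
by apply: eq_bigr => i _; rewrite mulrDl.
Qed.

Lemma fps_1neq0 (R : comNzRingType) : fpsC (1 : R) != 0.
Proof.
apply/eqP => /(congr1 (fun a => coefs a 0%N)) /= /eqP.
by rewrite oner_eq0.
Qed.

HB.instance Definition _ (R : comNzRingType) :=
  GRing.Zmodule_isComNzRing.Build (fps R)
    (@fps_mulA R) (@fps_mulC R) (@fps_mul1 R) (@fps_mulDl R) (fps_1neq0 R).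

Lemma coefs0 (R : zmodType) n : coefs (0 : fps R) n = 0.
Proof. by []. Qed.
Lemma coefsN (R : zmodType) (a : fps R) n : coefs (- a) n = - coefs a n.
Proof. by []. Qed.
Lemma coefsD (R : zmodType) (a b : fps R) n :
  coefs (a + b) n = coefs a n + coefs b n.
Proof. by []. Qed.
Lemma coefs1 (R : comNzRingType) n : coefs (1 : fps R) n = (n == 0%N)%:R.
Proof. by case: n. Qed.
Lemma coefsM (R : comNzRingType) (a b : fps R) n :
  coefs (a * b) n = \sum_(i < n.+1) coefs a i * coefs b (n - i)%N.
Proof. by []. Qed.

(* [course_of_values step] is the sequence [u] whose [n]-th term is [step n v],
   where [v] agrees with [u] below [n]. *)
Fixpoint cov_prefix (T : Type) (x0 : T) (step : nat -> (nat -> T) -> T) (n : nat)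
    : seq T :=
  if n is m.+1 then
    let s := cov_prefix x0 step m in rcons s (step m (nth x0 s))
  else [::].
Definition course_of_values (T : Type) (x0 : T) (step : nat -> (nat -> T) -> T)
    (n : nat) : T := step n (nth x0 (cov_prefix x0 step n)).

Lemma nth_cov_prefix (T : Type) (x0 : T) step n i : (i < n)%N ->
  nth x0 (cov_prefix x0 step n) i = course_of_values x0 step i.
Proof.
have szP m : size (cov_prefix x0 step m) = m.
  by elim: m => //= m IHm; rewrite size_rcons IHm.
elim: n => //= n IHn; rewrite ltnS leq_eqVlt nth_rcons szP.
by case/predU1P => [-> | lt_in]; rewrite ?ltnn ?eqxx // lt_in IHn.
Qed.

Definition fps_unit (R : comUnitRingType) : {pred fps R} :=
  fun a => coefs a 0 \is a GRing.unit.
Definition fps_inv_step (R : comUnitRingType) (a : fps R) (n : nat)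
    (b : nat -> R) : R :=
  (coefs a 0)^-1 * ((n == 0%N)%:R - \sum_(i < n) coefs a (n - i)%N * b i).
Definition fps_inv (R : comUnitRingType) (a : fps R) : fps R :=
  if fps_unit a then
    Fps (course_of_values 0 (fps_inv_step a))
  else a.

Lemma fps_mulVx (R : comUnitRingType) :
  {in @fps_unit R, left_inverse 1 (@fps_inv R) *%R}.
Proof.
move=> a ua; rewrite /fps_inv (ua : fps_unit a).
have {}ua : coefs a 0 \is a GRing.unit by [].
apply: fpsP => n; rewrite coefs1 coefsM big_ord_recr /= subnn.
set step := fps_inv_step a.
have -> : course_of_values 0 step n =
  fps_inv_step a n (nth 0 (cov_prefix 0 step n)) by [].
rewrite /fps_inv_step mulrAC mulVr // mul1r.
rewrite addrC -addrA [- _ + _]addrC.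
rewrite (eq_bigr (fun i : 'I_n => coefs a (n - i)%N *
  nth 0 (cov_prefix 0 step n) i)) ?subrr ?addr0 //.
by move=> i _; rewrite nth_cov_prefix // mulrC.
Qed.

Lemma fps_unitPl (R : comUnitRingType) (a b : fps R) : b * a = 1 -> fps_unit a.
Proof.
move/(congr1 (fun c => coefs c 0%N)); rewrite coefsM coefs1 big_ord1 subnn => ba1.
by apply/unitrPr; exists (coefs b 0); rewrite mulrC.
Qed.

Lemma fps_invr_out (R : comUnitRingType) :
  {in [predC @fps_unit R], @fps_inv R =1 id}.
Proof. by move=> a ua; rewrite /fps_inv ifN. Qed.

HB.instance Definition _ (R : comUnitRingType) :=
  GRing.ComNzRing_hasMulInverse.Build (fps R)
    (@fps_mulVx R) (@fps_unitPl R) (@fps_invr_out R).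

Lemma fps_mulf_eq0 (R : idomainType) : GRing.integral_domain_axiom (fps R).
Proof.
move=> a b ab0; apply: contraT; rewrite negb_or => /andP[a0 b0].
have order (c : fps R) : c != 0 ->
    exists2 m, coefs c m != 0 & forall i, (i < m)%N -> coefs c i = 0.
  move=> c0; have ex : exists m, coefs c m != 0.
    apply: contrapT => nex; case/eqP: c0; apply: fpsP => m.
    by apply/eqP/negPn/negP => cm; apply: nex; exists m.
  exists (ex_minn ex); case: ex_minnP => // m _ minm i ltim.
  by apply/eqP; apply: contraTT ltim => /minm; rewrite -leqNgt.
have [m am mina] := order a a0; have [k bk minb] := order b b0.
have /eqP := congr1 (fun c => coefs c (m + k)%N) ab0.
rewrite coefsM coefs0 (bigD1 (Ordinal (ltn_addr k (ltnSn m)))) //= addKn.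
rewrite big1 ?addr0 ?mulf_eq0 ?(negbTE am) ?(negbTE bk) // => i neq_im.
have [lt_im | lt_mi | eq_im] := ltngtP i m; first by rewrite mina ?mul0r.
  rewrite (minb (m + k - i)%N) ?mulr0 // ltn_subLR ?ltn_add2r //.
  by rewrite -ltnS ltn_ord.
by case/eqP: neq_im; apply: val_inj.
Qed.

HB.instance Definition _ (R : idomainType) :=
  GRing.ComUnitRing_isIntegral.Build (fps R) (@fps_mulf_eq0 R).

Definition fpsX (R : comNzRingType) : fps R := Fps (fun n => (n == 1%N)%:R).

Definition fps_sqrt_step (R : comUnitRingType) (a : fps R) (n : nat)
    (s : nat -> R) : R :=
  if n == 0%N then 1 else
    (coefs a n - \sum_(1 <= i < n) s i * s (n - i)%N) / 2%:R.
(* The square root with constant term 1, meaningful when [coefs a 0 = 1] and 2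
   is a unit: [fps_sqrt_coef0], [fps_sqrtK] and [fps_sqrt_unique] below. *)
Definition fps_sqrt (R : comUnitRingType) (a : fps R) : fps R :=
  Fps (course_of_values 0 (fps_sqrt_step a)).

Lemma fps_sqrt_coef0 (R : comUnitRingType) (a : fps R) :
  coefs (fps_sqrt a) 0 = 1.
Proof. by []. Qed.

Lemma fps_sqrtK (R : comUnitRingType) (a : fps R) :
  (2%:R : R) \is a GRing.unit -> coefs a 0 = 1 -> fps_sqrt a ^+ 2 = a.
Proof.
move=> u2 a0; apply: fpsP => n; rewrite expr2 coefsM.
case: n => [|n]; first by rewrite big_ord1 fps_sqrt_coef0 mul1r a0.
rewrite big_ord_recl big_ord_recr /= subnn subn0.
set u := course_of_values 0 (fps_sqrt_step a).
rewrite -[u 0%N]/(1 : R) mul1r mulr1 addrCA -mulr2n -mulr_natr.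
have -> : u n.+1 = (coefs a n.+1 - \sum_(i < n) u (bump 0 i) *
    u (n.+1 - bump 0 i)%N) / 2%:R.
  rewrite {1}/u /course_of_values {1}/fps_sqrt_step /= big_add1 big_mkord.
  congr ((_ - _) / _); apply: eq_bigr => i _.
  rewrite -[rcons _ _]/(cov_prefix 0 (fps_sqrt_step a) n.+1).
  by rewrite !nth_cov_prefix // ?ltnS ?subSS ?leq_subr.
by rewrite divrK // addrC subrK.
Qed.

Lemma fps_sqrt_unique (R : idomainType) (a s : fps R) :
  (2%:R : R) \is a GRing.unit -> coefs a 0 = 1 ->
  coefs s 0 = 1 -> s ^+ 2 = a -> s = fps_sqrt a.
Proof.
move=> u2 a0 s0 sa; have /eqP := sa.
rewrite -{1}(fps_sqrtK u2 a0) eqf_sqr => /orP[/eqP // | /eqP sN].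
move: s0; rewrite sN coefsN fps_sqrt_coef0 => /eqP.
rewrite eq_sym -subr_eq0 opprK -[1 + 1]/(2%:R) => /eqP two0.
by rewrite two0 unitr0 in u2.
Qed.

Definition avoids132 (n : nat) (s : 'S_n) : bool :=
  [forall a : 'I_n, forall b : 'I_n, forall c : 'I_n,
    ((a < b)%N && (b < c)%N) ==> ~~ ((s a < s c)%N && (s c < s b)%N)].

Definition occurs231_at (n : nat) (s : 'S_n) (i : 'I_n) : bool :=
  [exists j : 'I_n, exists k : 'I_n,
    [&& j == i.+1 :> nat, k == i.+2 :> nat, (s k < s i)%N & (s i < s j)%N]].

Definition occ231 (n : nat) (s : 'S_n) : nat := #|[set i | occurs231_at s i]|.

Definition f231 (r n : nat) : nat :=
  #|[set s : 'S_n | avoids132 s && (occ231 s == r)]|.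

Definition F231r (r : nat) : fps rat := Fps (fun n => (f231 r n)%:R).

(* Bivariate series live in Q[[y]][[x]]: the outer index is the power of x, so
   that "constant term" of a square root means constant term in x. *)
Definition F231 : fps (fps rat) := Fps (fun n => Fps (fun r => coefs (F231r r) n)).

Definition serX : fps (fps rat) := fpsX (fps rat).
Definition serY : fps (fps rat) := fpsC (fpsX rat).

(* 0 as soon as a < b or b < 0; in particular binomz (-1) 0 = 0. *)
Definition binomz (a b : int) : nat :=
  match a, b with Posz m, Posz k => 'C(m, k) | _, _ => 0%N end.

(* Main.v *)
(** In a 1-3-2-avoiding permutation L n R, every letter of L exceeds every letter
    of R, so the permutation is determined by the standardizations of L and R,
    which are arbitrary avoiders.  Its occurrences of 231 are those of L, those
    of R and, when L and R are both nonempty, the one centred at n.  Hence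
    G = F - 1 satisfies G = x (1 + 2 G + y G^2).  Completing the square gives the
    closed form with the square root; extracting the coefficient of y^r gives
    G_r = q (sum of the G_i G_(r-1-i)) with q = x / (1 - 2 x) and G_0 = q, which
    is the Catalan recurrence up to powers of q. *)

Require Import Defs.
From HB Require Import structures.
From mathcomp Require Import all_boot all_order all_algebra all_fingroup.
From mathcomp Require Import zify ring.

Set Implicit Arguments.
Unset Strict Implicit.
Unset Printing Implicit Defensive.

Import GRing.Theory.
Local Open Scope ring_scope.

(** * Permutations as words over the natural numbers *)

(** On plain words, factors can be cut out and shifted without changing type. The head [x] plays the
    1 of the pattern, and [b], [c] play the 3 and the 2. *)
Fixpoint av132 (w : seq nat) : bool :=
  if w is x :: w' then
    pairwise (fun b c => ~~ ((x < c)%N && (c < b)%N)) w' && av132 w'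
  else true.

Fixpoint occ (w : seq nat) : nat :=
  if w is a :: w' then
    ((if w' is b :: c :: _ then (c < a)%N && (a < b)%N else false)
     + occ w')%N
  else 0%N.

Definition Av (n : nat) : seq (seq nat) := filter av132 (permutations (iota 0 n)).

Definition word (n : nat) (s : 'S_n) : seq nat := [seq val (s i) | i <- enum 'I_n].

Lemma size_word n (s : 'S_n) : size (word s) = n.
Proof. by rewrite size_map size_enum_ord. Qed.

Lemma nth_word n (s : 'S_n) (i : 'I_n) : nth 0%N (word s) i = s i.
Proof. by rewrite (nth_map i) ?size_enum_ord // nth_ord_enum. Qed.

Lemma word_inj n : injective (@word n).
Proof.
by move=> s t eq_st; apply/permP => i; apply: val_inj; rewrite /= -!nth_word eq_st.
Qed.

(** An injection between two duplicate-free lists of the same length n! is a bijection. *)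
Lemma perm_word n :
  perm_eq [seq word s | s <- enum {: 'S_n}] (permutations (iota 0 n)).
Proof.
have Uw : uniq [seq word s | s <- enum {: 'S_n}].
  by rewrite map_inj_uniq ?enum_uniq //; apply: word_inj.
have sub : {subset [seq word s | s <- enum {: 'S_n}] <= permutations (iota 0 n)}.
  move=> w /mapP[s _ ->]; rewrite mem_permutations.
  apply: uniq_perm; rewrite ?iota_uniq //.
    by rewrite map_inj_uniq ?enum_uniq // => i j /val_inj /perm_inj.
  move=> x; rewrite mem_iota /=; apply/mapP/idP => [[i _ ->] | lt_xn]; first exact: ltn_ord.
  by exists (s^-1%g (Ordinal lt_xn)); rewrite ?mem_enum ?permKV.
apply: uniq_perm; rewrite ?permutations_uniq //.
apply: (uniq_min_size Uw sub _).2.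
by rewrite size_permutations ?iota_uniq // size_iota size_map -cardE card_Sn.
Qed.

Lemma av132P w :
  reflect (forall a b c, (a < b)%N -> (b < c)%N -> (c < size w)%N ->
             ~~ ((nth 0%N w a < nth 0%N w c)%N && (nth 0%N w c < nth 0%N w b)%N))
          (av132 w).
Proof.
elim: w => [|x w IHw] /=; first by left.
apply: (iffP andP) => [[/(pairwiseP 0%N) pw /IHw av] | av].
  move=> [|a] [|b] [|c] //= ltab ltbc ltc; last exact: av.
  by apply: pw => //; apply: ltn_trans ltbc ltc.
split.
  by apply/(pairwiseP 0%N) => b c _ ltc ltbc; apply: (av 0%N b.+1 c.+1).
by apply/IHw => a b c ltab ltbc ltc; apply: (av a.+1 b.+1 c.+1).
Qed.

Lemma occE w :
  occ w = (\sum_(i < size w) [&& i.+2 < size w, nth 0 w i.+2 < nth 0 w i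
                               & nth 0 w i < nth 0 w i.+1])%N.
Proof.
elim: w => [|a w IHw]; first by rewrite big_ord0.
rewrite /= big_ord_recl {}IHw /=; congr (_ + _)%N.
by case: w => [|b [|c w]].
Qed.

Lemma avoids132_word n (s : 'S_n) : avoids132 s = av132 (word s).
Proof.
apply/idP/av132P => [/forallP av a b c ltab ltbc | av].
  rewrite size_word => ltc; have ltb := ltn_trans ltbc ltc.
  have lta := ltn_trans ltab ltb.
  have /forallP/(_ (Ordinal ltb))/forallP/(_ (Ordinal ltc)) := av (Ordinal lta).
  by rewrite /= ltab ltbc /= -!nth_word.
apply/forallP => a; apply/forallP => b; apply/forallP => c.
by apply/implyP => /andP[ltab ltbc]; rewrite -!nth_word av ?size_word.
Qed.

Lemma occ231_word n (s : 'S_n) : occ231 s = occ (word s).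
Proof.
rewrite occE size_word /occ231 -sum1dep_card big_mkcond /=.
apply: eq_bigr => i _; rewrite -[if _ then _ else _]/(nat_of_bool (occurs231_at s i)).
congr nat_of_bool; apply/existsP/and3P => [[j /existsP[k]] | [ltn lt1 lt2]].
  case/and4P => /eqP <- /eqP <- lt1 lt2.
  by rewrite !nth_word.
exists (Ordinal (ltnW ltn)); apply/existsP; exists (Ordinal ltn).
by rewrite /= !eqxx -!nth_word /= lt1.
Qed.

Lemma f231_count r n : f231 r n = count (fun w => occ w == r) (Av n).
Proof.
rewrite count_filter -(seq.permP (perm_word n)) count_map -sum1_count.
rewrite big_enum_cond /= sum1dep_card /f231; apply: eq_card => s.
by rewrite !inE avoids132_word occ231_word andbC.
Qed.

(** * Decomposition of an avoider at its largest letter *)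

(** The strict maximum [m] can only play the 3, with the 1 in [L] and the 2 in [R]; [allrel geq L R]
    says exactly that this never happens. Under that condition a pattern whose 1 lies in [L] also
    has its 2 in [L], so no pattern straddles the cut. *)
Lemma av132_cat (L R : seq nat) m :
  all (gtn m) L -> all (gtn m) R ->
  av132 (L ++ m :: R) = [&& av132 L, av132 R & allrel geq L R].
Proof.
elim: L => [_ ltR | x L IHL] /=.
  rewrite andbT -[RHS]andTb; congr andb.
  elim: R ltR => //= y R IHR /andP[lty ltR]; rewrite IHR // andbT.
  by apply/allP => z zR /=; rewrite [(m < z)%N]ltnNge (ltnW (allP ltR z zR)).
case/andP => ltx ltL ltR; rewrite IHL // allrel_consl pairwise_cat /=.
rewrite allrel_consr.
have -> : all (fun b => ~~ ((x < m)%N && (m < b)%N)) L.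
  by apply/allP => z zL; rewrite [(m < z)%N]ltnNge (ltnW (allP ltL z zL)) andbF.
have -> : all (fun c => ~~ ((x < c)%N && (c < m)%N)) R = all (geq x) R.
  by apply: eq_in_all => z zR; rewrite (allP ltR z zR : z < m)%N andbT -leqNgt.
case: (boolP (all (geq x) R)) => [leR | _]; last by rewrite !(andbF, andFb).
have -> : allrel (fun b c => ~~ ((x < c)%N && (c < b)%N)) L R.
  by apply/allrelP => y z _ zR; rewrite [(x < z)%N]ltnNge (allP leR z zR : z <= x)%N.
have -> : pairwise (fun b c => ~~ ((x < c)%N && (c < b)%N)) R.
  apply/(pairwiseP 0%N) => i j _ ltj _.
  have lejx := allP leR _ (mem_nth 0%N ltj).
  by rewrite /= ltnNge (lejx : nth 0 R j <= x)%N.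
by rewrite /= !andbT !andbA.
Qed.

(** A window of three consecutive letters that contains [m] can be an occurrence only with [m] in
    the middle. Such a window exists when [L] and [R] are both nonempty, and is then always an
    occurrence: [uniq] makes the inequality between its outer letters strict. *)
Lemma occ_cat (L R : seq nat) m :
  all (gtn m) L -> all (gtn m) R -> uniq (L ++ R) -> allrel geq L R ->
  occ (L ++ m :: R) = ((L != [::]) && (R != [::]) + occ L + occ R)%N.
Proof.
elim: L => [_ ltR _ _ | a L IHL] /=.
  case: R ltR => [|b [|c R]] //= /and3P[ltb _ _].
  by rewrite [(m < b)%N]ltnNge (ltnW ltb) andbF.
case/andP => lta ltL ltR /andP[aN U]; rewrite allrel_consl => /andP[lea le].
(* The window starting at [a] has [m] in the middle, has [m] at the end, or stays inside the left
   factor. *)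
rewrite {}IHL //; case: L ltL aN le {U} => [|b [|c L]] /= ltL aN le.
- case: R ltR aN lea {le} => [|c R] //= _.
  rewrite inE negb_or => /andP[neq _] /andP[lec _].
  by rewrite lta ltn_neqAle eq_sym neq lec.
- by rewrite [(m < a)%N]ltnNge (ltnW lta).
lia.
Qed.

Lemma av132_map_addn d w : av132 (map (addn d) w) = av132 w.
Proof.
elim: w => //= x w ->; congr andb; rewrite pairwise_map.
by apply: eq_pairwise => y z /=; rewrite !ltn_add2l.
Qed.

Lemma occ_map_addn d w : occ (map (addn d) w) = occ w.
Proof.
by elim: w => //= x [|b [|c w]] -> //=; rewrite !ltn_add2l.
Qed.


(** Sorting [R] and [L] separately and concatenating gives a sorted permutation of [iota 0 n], hence
    [iota 0 n] itself; cutting it at [size R] identifies both factors. *)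
Lemma split_perm_iota n L R :
  perm_eq (L ++ R) (iota 0 n) -> allrel geq L R ->
  perm_eq R (iota 0 (size R)) /\ perm_eq L (iota (size R) (size L)).
Proof.
move=> permLR leRL.
have eqn : n = (size R + size L)%N.
  by rewrite -(size_iota 0 n) -(perm_size permLR) size_cat addnC.
have sorted_id (s : seq nat) : sorted leq s -> sort leq s = s.
  by apply: sorted_sort; apply: leq_trans.
have : sort leq R ++ sort leq L = iota 0 (size R) ++ iota (size R) (size L).
  rewrite -{2}[size R]add0n -iotaD -eqn.
  apply: (sorted_eq leq_trans anti_leq); last 2 first.
  - exact: iota_sorted.
  - rewrite perm_catC (perm_trans _ permLR) //.
    by apply: perm_cat; rewrite perm_sort.
  rewrite (sorted_pairwise leq_trans) pairwise_cat.
  rewrite -!(sorted_pairwise leq_trans) !(sort_sorted leq_total).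
  rewrite /= andbT; apply/allrelP => x y; rewrite !mem_sort => xR yL.
  exact: (allrelP leRL).
move/eqP; rewrite eqseq_cat ?size_sort ?size_iota // => /andP[/eqP <- /eqP <-].
by rewrite ![perm_eq _ (sort _ _)]perm_sym !perm_sort.
Qed.

(* The 1-3-2-avoider L' n R, where L' is L shifted above R. *)
Definition glue (n k : nat) (p : seq nat * seq nat) : seq nat :=
  map (addn (n - k)) p.1 ++ n :: p.2.

Lemma AvP n w : w \in Av n -> [/\ av132 w, perm_eq w (iota 0 n) & size w = n].
Proof.
rewrite mem_filter mem_permutations => /andP[av pw].
by rewrite (perm_size pw) size_iota.
Qed.

Lemma perm_glue n k L R : (k <= n)%N ->
  perm_eq L (iota 0 k) -> perm_eq R (iota 0 (n - k)) ->
  perm_eq (glue n k (L, R)) (iota 0 n.+1).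
Proof.
move=> lekn pL pR; rewrite /glue -cat1s.
have -> : iota 0 n.+1 = iota 0 (n - k) ++ iota (n - k) k ++ [:: n].
  rewrite catA -{2}[(n - k)%N]add0n -iotaD subnK //.
  by rewrite -addn1 iotaD.
rewrite catA perm_catC; apply: perm_cat => //; apply: perm_cat => //.
by rewrite -{2}[(n - k)%N]addn0 iotaDl; apply: perm_map.
Qed.

Lemma glue_bounds n k L R : (k <= n)%N ->
  perm_eq L (iota 0 k) -> perm_eq R (iota 0 (n - k)) ->
  [/\ all (gtn n) (map (addn (n - k)) L), all (gtn n) R
    & allrel geq (map (addn (n - k)) L) R].
Proof.
move=> lekn pL pR; have memL x : (x \in L) = (x < k)%N.
  by rewrite (perm_mem pL) mem_iota.
have memR x : (x \in R) = (x < n - k)%N by rewrite (perm_mem pR) mem_iota.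
split.
- by apply/allP => _ /mapP[x + ->] /=; rewrite memL; lia.
- by apply/allP => x /=; rewrite memR; lia.
- by apply/allrelP => _ y /mapP[x _ ->] /=; rewrite memR; lia.
Qed.

Lemma glue_Av n k L R : (k <= n)%N -> L \in Av k -> R \in Av (n - k) ->
  glue n k (L, R) \in Av n.+1.
Proof.
move=> lekn /AvP[avL pL _] /AvP[avR pR _].
have [ltL ltR le] := glue_bounds lekn pL pR.
rewrite mem_filter mem_permutations perm_glue // andbT.
by rewrite av132_cat // av132_map_addn avL avR.
Qed.

Lemma occ_glue n k L R : (k <= n)%N -> L \in Av k -> R \in Av (n - k) ->
  occ (glue n k (L, R)) = ((k != 0) && (n - k != 0) + occ L + occ R)%N.
Proof.
move=> lekn /AvP[_ pL szL] /AvP[_ pR szR].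
have [ltL ltR le] := glue_bounds lekn pL pR.
rewrite occ_cat // ?occ_map_addn //.
  by rewrite -!size_eq0 size_map szL szR.
have := perm_uniq (perm_glue lekn pL pR).
by rewrite iota_uniq /glue -cat1s uniq_catCA /= => /andP[].
Qed.

(** Both lists are duplicate-free, so equality of their members suffices; injectivity and
    surjectivity of [glue] are proved in turn. *)
Lemma Av_perm n :
  perm_eq (Av n.+1)
    [seq glue n k p | k <- iota 0 n.+1,
                      p <- [seq (L, R) | L <- Av k, R <- Av (n - k)]].
Proof.
have Uav m : uniq (Av m) by rewrite filter_uniq ?permutations_uniq.
apply: uniq_perm => //.
  apply: allpairs_uniq_dep; first exact: iota_uniq.
    by move=> k _; apply: allpairs_uniq => // -[L1 R1] [L2 R2].
  pose T := fun k : nat => (seq nat * seq nat)%type.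
  move=> p q /(@allpairsPdep _ T)[k [u [kn up ->]]].
  move=> /(@allpairsPdep _ T)[k' [u' [kn' uq ->]]] /=.
  case/allpairsP: up => [[L R] /= [LA RA ->]].
  case/allpairsP: uq => [[L' R'] /= [LA' RA' ->]].
  have [_ _ szL] := AvP LA; have [_ _ szL'] := AvP LA'.
  have lek : (k <= n)%N by move: kn; rewrite mem_iota.
  have lek' : (k' <= n)%N by move: kn'; rewrite mem_iota.
  (* The length of the left factor is recovered as the position of the largest letter. *)
  have idx m L0 R0 : (m <= n)%N -> L0 \in Av m -> R0 \in Av (n - m) ->
      index n (glue n m (L0, R0)) = m.
    move=> le /AvP[_ pL0 sz0] /AvP[_ pR0 _].
    have [/allP lt0 _ _] := glue_bounds le pL0 pR0.
    rewrite index_cat /= eqxx addn0 size_map sz0 ifN //.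
    by apply/negP => /lt0 /=; rewrite ltnn.
  move=> eq_glue; have eqk : k = k'.
    by rewrite -(idx _ _ _ lek LA RA) eq_glue idx.
  move: eq_glue; rewrite -{}eqk in szL' *; move/eqP.
  rewrite /glue eqseq_cat ?size_map ?szL ?szL' //= eqseq_cons eqxx /=.
  by case/andP => /eqP/(inj_map (@addnI _)) -> /eqP ->.
move=> w; apply/idP/allpairsPdep => [/AvP[av pw szw] | [k [u [kn]]]].
  have nw : n \in w by rewrite (perm_mem pw) mem_iota /= add0n.
  case/splitPr: nw av pw szw => L R av pw szw.
  have pLR : perm_eq (L ++ R) (iota 0 n).
    rewrite -(perm_cons n) (perm_trans _ (perm_trans pw _)) //.
      by rewrite perm_sym perm_catC /= perm_cons perm_catC.
    by rewrite -addn1 iotaD perm_catC.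
  have ltLR x : x \in L ++ R -> (x < n)%N by rewrite (perm_mem pLR) mem_iota.
  have ltL : all (gtn n) L by apply/allP => x xL; rewrite /= ltLR ?mem_cat ?xL.
  have ltR : all (gtn n) R by apply/allP => x xR; rewrite /= ltLR ?mem_cat ?xR ?orbT.
  move: av; rewrite av132_cat // => /and3P[avL avR le].
  have [pR pL] := split_perm_iota pLR le.
  have szLR : n = (size L + size R)%N by rewrite -size_cat (perm_size pLR) size_iota.
  (* Standardization of [L]; the truncated subtraction loses nothing because the letters of [L] are
     at least [size R]. *)
  pose L' := map (subn^~ (size R)) L.
  have szR : (n - size L)%N = size R by rewrite szLR addKn.
  have LE : L = map (addn (n - size L)) L'.
    rewrite szR -map_comp map_id_in // => x xL /=; rewrite subnKC //.
    by move: xL; rewrite (perm_mem pL) mem_iota => /andP[].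
  exists (size L), (L', R); split.
  - by rewrite mem_iota leq0n add0n ltnS szLR leq_addr.
  - apply: allpairs_f; rewrite mem_filter mem_permutations ?avR ?szR //.
    rewrite -(av132_map_addn (n - size L)) -LE avL /=.
    have -> : iota 0 (size L) = map (subn^~ (size R)) (iota (size R) (size L)).
      rewrite -{2}[size R]addn0 iotaDl -map_comp map_id_in // => x _ /=.
      by rewrite addKn.
    exact: perm_map.
  - by rewrite /glue /= -LE.
case/allpairsP=> [[L R] [LA RA ->]] ->; apply: glue_Av => //.
by move: kn; rewrite mem_iota.
Qed.

(** * Coefficients of series and the functional equation *)

Lemma coefsXM (R : comNzRingType) (a : fps R) n :
  coefs (fpsX R * a) n = if n is m.+1 then coefs a m else 0.
Proof.
rewrite coefsM; case: n => [|n]; first by rewrite big_ord1 mul0r.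
rewrite big_ord_recl mul0r add0r big_ord_recl mul1r subn1 big1 ?addr0 // => i _.
by rewrite mul0r.
Qed.

Lemma coefsCM (R : comNzRingType) (c : R) (a : fps R) n :
  coefs (fpsC c * a) n = c * coefs a n.
Proof.
by rewrite coefsM big_ord_recl /= subn0 big1 ?addr0 // => i _; rewrite mul0r.
Qed.

Lemma coefs_sum (R : zmodType) (I : Type) (s : seq I) (F : I -> fps R) n :
  coefs (\sum_(i <- s) F i) n = \sum_(i <- s) coefs (F i) n.
Proof. by apply: (big_morph (fun a => coefs a n)) => //; apply: coefsD. Qed.

Lemma coefsXn (R : comNzRingType) k n : coefs (fpsX R ^+ k) n = (n == k)%:R.
Proof.
elim: k n => [|k IHk] n; first by rewrite expr0 coefs1.
by rewrite exprS coefsXM; case: n.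
Qed.

(** The inner variable [fpsX rat] is y, so each avoider contributes the monomial recording its
    number of occurrences. *)
Lemma coefs_F231 n : coefs F231 n = \sum_(w <- Av n) fpsX rat ^+ occ w.
Proof.
apply: fpsP => r; rewrite coefs_sum /= f231_count -sum1_count natr_sum big_mkcond.
by apply: eq_bigr => w _; rewrite coefsXn eq_sym; case: ifP.
Qed.

Lemma coefs_F231_0 : coefs F231 0 = 1.
Proof. by rewrite coefs_F231 big_seq1. Qed.

Lemma coefs_F231_rec n :
  coefs F231 n.+1 = \sum_(i < n.+1)
    fpsX rat ^+ ((i != 0 :> nat) && (n - i != 0))%N * coefs F231 i * coefs F231 (n - i).
Proof.
rewrite coefs_F231 (perm_big _ (Av_perm n)) big_allpairs_dep.
rewrite -[iota 0 n.+1]/(index_iota 0 n.+1) big_mkord; apply: eq_bigr => k _.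
have lekn : (k <= n)%N by rewrite -ltnS.
rewrite big_allpairs !coefs_F231 -mulrA mulr_suml mulr_sumr; apply: eq_big_seq => L LA.
rewrite !mulr_sumr; apply: eq_big_seq => R RA.
by rewrite occ_glue // !exprD mulrA.
Qed.

Lemma F231_eq :
  F231 - 1 = serX * (serY * (F231 - 1) ^+ 2 + 2%:R * (F231 - 1) + 1).
Proof.
set G := F231 - 1.
have G0 : coefs G 0 = 0 by rewrite coefsD coefs_F231_0 subrr.
have FE n : coefs F231 n = coefs G n + (n == 0%N)%:R.
  by rewrite -coefs1 -coefsD subrK.
apply: fpsP => -[|n]; rewrite coefsXM //.
have -> : coefs G n.+1 = coefs F231 n.+1 by rewrite FE addr0.
(* The four products correspond to the left and right factors being nonempty ([G]) or empty ([1]),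
   so that the convolutions match term by term. *)
have -> : serY * G ^+ 2 + 2%:R * G + 1 = serY * (G * G) + G * 1 + 1 * G + 1 * 1 by ring.
rewrite coefs_F231_rec !coefsD coefsCM !coefsM mulr_sumr -!big_split.
clearbody G; apply: eq_bigr => i _; rewrite !FE !coefs1 /=.
case: (i : nat) (n - i)%N => [|k] [|l] /=; rewrite ?G0; ring.
Qed.

(** * Closed form with the square root *)

Lemma coefs0_serX (a : fps (fps rat)) : coefs (serX * a) 0 = 0.
Proof. by rewrite coefsXM. Qed.

Lemma F231_sqrt :
  1 - 2%:R * serX + 2%:R * serX * serY
    - fps_sqrt (1 - 4%:R * serX + 4%:R * serX ^+ 2 - 4%:R * serX ^+ 2 * serY)
  = 2%:R * serX * serY * F231.
Proof.
have Feq := F231_eq; set G := F231 - 1 in Feq.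
have -> : F231 = G + 1 by rewrite subrK.
(* Completing the square in x y G^2 - (1 - 2x) G + x = 0 gives this root of the discriminant (1 -
   2x)^2 - 4 x^2 y; its constant term 1 selects the sign. *)
rewrite -(@fps_sqrt_unique _ _ (1 - 2%:R * serX - 2%:R * serX * serY * G)).
- ring.
- by [].
- have -> : 1 - 4%:R * serX + 4%:R * serX ^+ 2 - 4%:R * serX ^+ 2 * serY
     = 1 + serX * (- 4%:R + 4%:R * serX - 4%:R * serX * serY) by ring.
  by rewrite coefsD coefs0_serX addr0.
- have -> : 1 - 2%:R * serX - 2%:R * serX * serY * G
     = 1 + serX * (- 2%:R - 2%:R * serY * G) by ring.
  by rewrite coefsD coefs0_serX addr0.
- apply/eqP; rewrite -subr_eq0.
  have -> : (1 - 2%:R * serX - 2%:R * serX * serY * G) ^+ 2 -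
     (1 - 4%:R * serX + 4%:R * serX ^+ 2 - 4%:R * serX ^+ 2 * serY)
     = 4%:R * serX * serY * (serX * (serY * G ^+ 2 + 2%:R * G + 1) - G) by ring.
  by rewrite -Feq subrr mulr0.
Qed.

Lemma fpsX_neq0 (R : comNzRingType) : fpsX R != 0.
Proof.
apply/eqP => /(congr1 (fun a => coefs a 1%N)) /eqP.
by rewrite coefs0 oner_eq0.
Qed.

(** The quotient is taken in the fraction field, since 2xy is nonzero but not invertible among the
    series. *)
Lemma F231_tofrac :
  tofrac F231 =
    tofrac (1 - 2%:R * serX + 2%:R * serX * serY
            - fps_sqrt (1 - 4%:R * serX + 4%:R * serX ^+ 2
                        - 4%:R * serX ^+ 2 * serY))
    / tofrac (2%:R * serX * serY).
Proof.
rewrite F231_sqrt tofracM mulrAC divff ?mul1r // tofrac_eq0 !mulf_neq0 ?fpsX_neq0 //.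
- apply/eqP => /(congr1 (fun a => coefs (coefs a 0) 0)) /eqP.
  by [].
- apply/eqP => /(congr1 (fun a => coefs a 0%N)) /eqP.
  by rewrite coefs0 (negPf (fpsX_neq0 _)).
Qed.

(** * Catalan numbers and their convolution *)

Definition catalan (r : nat) : rat := 'C(2 * r, r)%:R / r.+1%:R.

(** Two absorption identities link both central coefficients to C(2r + 1, r). *)
Lemma central_binS r :
  'C(2 * r.+1, r.+1)%:R = 2%:R * (2%:R * r%:R + 1) / r.+1%:R * 'C(2 * r, r)%:R :> rat.
Proof.
have H : (r.+1 * 'C(2 * r.+1, r.+1) = r.+1 * (2 * 'C((2 * r).+1, r)))%N.
  by rewrite mulnS -mul_bin_diag /=; ring.
have H' : ((2 * r).+1 * 'C(2 * r, r) = r.+1 * 'C((2 * r).+1, r))%N.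
  by rewrite mul_bin_down; congr (_ * _)%N; lia.
have r1 : r.+1%:R != 0 :> rat by rewrite Num.Theory.pnatr_eq0.
apply: (mulfI r1); rewrite -[LHS]natrM H [_ / _ * _]mulrAC [RHS]mulrC divfK //.
rewrite !natrM (mulrCA _ 2%:R) -mulrA; congr (_ * _).
by rewrite -[LHS]natrM -H' natrM -natr1 natrM.
Qed.

(* With B j = C(2j, j), the summand is a discrete derivative (Gosper):
   C_i C_(n-i) = g (i + 1) - g i for
   g i = B i * B (n + 1 - i) * (2 i - n - 1) / (2 (n + 1) (n + 2)). *)
Lemma catalan_conv n : catalan n.+1 = \sum_(i < n.+1) catalan i * catalan (n - i).
Proof.
pose B j : rat := 'C(2 * j, j)%:R.
pose g i : rat := B i * B (n.+1 - i)%N * (2%:R * i%:R - n%:R - 1)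
                  / (2%:R * n.+1%:R * n.+2%:R).
have nz m : m.+1%:R != 0 :> rat by rewrite Num.Theory.pnatr_eq0.
have gosper i : (i <= n)%N -> catalan i * catalan (n - i) = g i.+1 - g i.
  move=> lein; rewrite /catalan /g subSS subSn // /B !central_binS.
  have En : n%:R = i%:R + (n - i)%:R :> rat by rewrite -natrD subnKC.
  have := nz i; have := nz (n - i)%N; have := nz n; have := nz n.+1.
  rewrite -!natr1 En; move: (n - i)%N => m nz1 nz2 nz3 nz4.
  field.
  by rewrite ?nz1 ?nz2 ?nz3 ?nz4.
have := telescope_sumr g (leq0n n.+1).
rewrite big_mkord (eq_bigr (fun i : 'I_n.+1 => catalan i * catalan (n - i))); last first.
  by move=> i _; rewrite gosper // -ltnS.
(* The end values [g n.+1] and [g 0] are plus and minus half of [catalan n.+1]. *)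
move=> ->; rewrite /g subnn subn0 /B /catalan bin0.
have := nz n; have := nz n.+1; rewrite -!natr1 => nz1 nz2; field.
by rewrite nz1 nz2.
Qed.

(** * Powers of x / (1 - 2x) *)

Lemma fpsCM (R : comNzRingType) (a b : R) : fpsC (a * b) = fpsC a * fpsC b.
Proof. by apply: fpsP => n; rewrite coefsCM /=; case: n => //; rewrite mulr0. Qed.

Lemma fpsCD (R : zmodType) (a b : R) : fpsC (a + b) = fpsC a + fpsC b.
Proof. by apply: fpsP => -[|n] //; rewrite coefsD /= addr0. Qed.

Lemma fpsC_nat (R : comNzRingType) n : fpsC (n%:R : R) = n%:R.
Proof.
elim: n => [|n IHn]; first by apply: fpsP => -[].
by rewrite -!natr1 fpsCD IHn.
Qed.

Definition xgeom : fps rat := fpsX rat / (1 - 2%:R * fpsX rat).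

Lemma unit_1sub2X : 1 - 2%:R * fpsX rat \is a GRing.unit.
Proof.
rewrite -[_ \is a _]/(coefs (1 - 2%:R * fpsX rat) 0 \is a GRing.unit).
by rewrite mulrC coefsD coefsN coefsXM subr0 unitr1.
Qed.

Lemma xgeomE (a b : fps rat) : a = fpsX rat * (b + 2%:R * a) -> a = xgeom * b.
Proof.
move=> eqa; apply: (mulIr unit_1sub2X).
have -> : xgeom * b * (1 - 2%:R * fpsX rat) = fpsX rat * b.
  by rewrite mulrAC [xgeom * _]divrK // unit_1sub2X.
by rewrite mulrBr mulr1 {1}eqa; ring.
Qed.

(** By induction on [m]: through [xgeomE], multiplication by [xgeom] becomes Pascal's rule scaled by
    powers of 2. For [k < m] the exponent is negative, but the binomial coefficient vanishes. *)
Lemma coefs_xgeom m n :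
  coefs (xgeom ^+ m.+1) n =
    if n is k.+1 then (2%:R : rat) ^ (k%:Z - m%:Z) * 'C(k, m)%:R else 0.
Proof.
pose P m := Fps (fun n =>
  if n is k.+1 then (2%:R : rat) ^ (k%:Z - m%:Z) * 'C(k, m)%:R else 0).
suff -> : xgeom ^+ m.+1 = P m by [].
clear n; elim: m => [|m IHm].
  rewrite expr1 -[LHS]mulr1; apply/esym/xgeomE/fpsP => n.
  rewrite coefsXM; case: n => [//|n]; rewrite coefsD coefs1 -fpsC_nat coefsCM /=.
  case: n => [|n] /=; first by rewrite mulr0 addr0.
  by rewrite !bin0 !mulr1 add0r !subr0 exprSz.
rewrite exprS IHm; apply/esym/xgeomE/fpsP => n.
rewrite coefsXM; case: n => [//|n]; rewrite coefsD -fpsC_nat coefsCM /=.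
case: n => [|n] /=; first by rewrite !mulr0 addr0.
have exprSz2 z : 2%:R * (2%:R : rat) ^ z = 2%:R ^ (1 + z) by rewrite expfzDr.
by rewrite binS natrD mulrDr addrC mulrA exprSz2; congr (_ ^ _ * _ + _ ^ _ * _); lia.
Qed.

(** * Extraction of the coefficients of y^r *)

(** This is G_r, the coefficient of y^r in G = F - 1; only r = 0 involves the empty permutation. *)
Definition F231r_pos (r : nat) : fps rat := F231r r - (r == 0%N)%:R.

(** The coefficient of y^r in [F231_eq], read as a series in x: exchanging the two convolution sums
    turns y G^2 into a sum of products of the G_i. *)
Lemma F231r_pos_eq r :
  F231r_pos r = fpsX rat *
    ((if r is s.+1 then \sum_(i < s.+1) F231r_pos i * F231r_pos (s - i) else 1)
     + 2%:R * F231r_pos r).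
Proof.
have Gc n s : coefs (coefs (F231 - 1) n) s = coefs (F231r_pos s) n.
  rewrite /F231r_pos !(coefsD, coefsN); congr (_ - _).
  by rewrite coefs1; case: n s => [|n] [|s].
have := F231_eq; move: (F231 - 1) Gc => G Gc Geq.
apply: fpsP => n; rewrite coefsXM -Gc Geq coefsXM; case: n => [//|n].
rewrite !mulr_natl !mulr2n !coefsD coefsCM !Gc addrAC; congr (_ + _).
rewrite coefsXM coefs1; case: r => [|s]; first by rewrite add0r coefs1; case: n.
rewrite expr2 coefsM !coefs_sum.
have -> : coefs ((n == 0%N)%:R : fps rat) s.+1 = 0 by case: (n == 0%N).
rewrite addr0; under eq_bigr do rewrite coefsM.
rewrite exchange_big; apply: eq_bigr => j _; rewrite coefsM.
by apply: eq_bigr => i _; rewrite !Gc.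
Qed.

Lemma F231r_posE r : F231r_pos r = fpsC (catalan r) * xgeom ^+ (2 * r).+1.
Proof.
elim/ltn_ind: r => -[|s] IHr; rewrite (xgeomE (F231r_pos_eq _)).
  by rewrite mulr1 expr1 /catalan bin0 divr1 (fpsC_nat _ 1) mul1r.
rewrite catalan_conv.
have -> : fpsC (\sum_(i < s.+1) catalan i * catalan (s - i))
   = \sum_(i < s.+1) fpsC (catalan i) * fpsC (catalan (s - i)).
  by rewrite (big_morph _ (@fpsCD _) (fpsC_nat _ 0)); apply: eq_bigr => i _; rewrite fpsCM.
rewrite mulr_sumr mulr_suml; apply: eq_bigr => i _.
have lei : (i <= s)%N by rewrite -ltnS.
rewrite !IHr ?ltnS ?leq_subr //.
(* Every summand carries the same power of [xgeom], leaving only the Catalan convolution. *)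
have -> : (2 * s.+1).+1 = (1 + (2 * i).+1 + (2 * (s - i)).+1)%N by lia.
by rewrite !exprD expr1; ring.
Qed.

(* The correction terms (r == 0) and (r == 0) && (n == 0) account for the empty
   permutation, which the closed forms for r = 0 do not count. *)
Theorem theorem3p2 :
  [/\ tofrac F231 =
        tofrac (1 - 2%:R * serX + 2%:R * serX * serY
                - fps_sqrt (1 - 4%:R * serX + 4%:R * serX ^+ 2
                            - 4%:R * serX ^+ 2 * serY))
        / tofrac (2%:R * serX * serY),
      forall r : nat,
        F231r r =
          (r == 0%N)%:R
          + (r.+1%:R)^-1 * (binomz (2 * r)%N r)%:R
            * (fpsX rat ^+ (2 * r + 1)
               / (1 - 2%:R * fpsX rat) ^+ (2 * r + 1))
    & forall r n : nat,
        (f231 r n)%:R =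
          ((r == 0%N) && (n == 0%N))%:R
          + (2%:R : rat) ^ (n%:Z - (2 * r)%:Z - 1) / r.+1%:R
            * (binomz (n%:Z - 1) (2 * r)%N)%:R * (binomz (2 * r)%N r)%:R].
Proof.
have FE r : F231r r = (r == 0%N)%:R + fpsC (catalan r) * xgeom ^+ (2 * r).+1.
  by rewrite -F231r_posE addrC subrK.
split; first exact: F231_tofrac.
  move=> r; rewrite FE addn1 -expr_div_n; congr (_ + _ * _).
  rewrite fpsCM fpsC_nat mulrC; congr (_ * _).
  have r1 : r.+1%:R != 0 :> rat by rewrite Num.Theory.pnatr_eq0.
  have inv1 : fpsC (r.+1%:R^-1) * r.+1%:R = 1 :> fps rat.
    by rewrite -(fpsC_nat _ r.+1) -fpsCM mulVf.
  have u : r.+1%:R \is a @GRing.unit (fps rat).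
    by apply/unitrPr; exists (fpsC (r.+1%:R^-1)); rewrite mulrC.
  by apply: (mulIr u); rewrite inv1 mulVr.
move=> r n; rewrite -[LHS]/(coefs (F231r r) n) FE coefsD coefsCM coefs_xgeom.
congr (_ + _); first by case: r n => [|r] [|n].
(* At [n = 0] both sides vanish: powers of [xgeom] with positive exponent have no constant term, and
   [binomz] is 0 at top index -1. *)
case: n => [|n]; first by rewrite /= !(mulr0, mul0r).
have En : n.+1%:Z - 1 = n by rewrite -addn1 PoszD addrK.
rewrite [_ - _ - 1]addrAC !En /= /catalan.
ring.
Qed.
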